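(* For a permutation (matrix) $\boldsymbol{P}$ of even order $K$, the Gaussian distribution $\mathcal{N}(\boldsymbol{w}_0,\boldsymbol{P}_0)$ of $\boldsymbol{P}$-skew-invariant tensors is described by a mean vector $\boldsymbol{w}_0$ that is $\boldsymbol{P}$-skew-invariant and covariance matrix $$\boldsymbol{P}_0:=\frac{-\boldsymbol{P}+\boldsymbol{P}^2-\cdots+\boldsymbol{P}^K}{K}=\frac{\sum_{k=1}^K(-1)^k\,\boldsymbol{P}^k}{K}.$$
   Context: Here $\boldsymbol{P}\in\mathbb{R}^{J^D\times J^D}$ is a permutation matrix. Its order $K$ is the smallest natural number such that $\boldsymbol{P}^K=\boldsymbol{I}$. A tensor $\mathcal{W}\in\mathbb{R}^{J\times\cdots\times J}$ ($D$ modes, a $D$-dimensional real array) with vectorization $\boldsymbol{w}=\mathrm{vec}(\mathcal{W})\in\mathbb{R}^{J^D}$ is called $\boldsymbol{P}$-skew-invariant (or skew-$\boldsymbol{P}$-invariant) if $\boldsymbol{P}\boldsymbol{w}=-\boldsymbol{w}$; a vector $\boldsymbol{w}_0\in\mathbb{R}^{J^D}$ is likewise $\boldsymbol{P}$-skew-invariant if $\boldsymbol{P}\boldsymbol{w}_0=-\boldsymbol{w}_0$. $\mathcal{N}(\boldsymbol{w}_0,\boldsymbol{P}_0)$ denotes the Gaussian distribution of the vectorization $\boldsymbol{w}$ with mean vector $\boldsymbol{w}_0$ and covariance matrix $\boldsymbol{P}_0$. *)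

(* Defs.v *)
From HB Require Import structures.
From mathcomp Require Import all_boot all_order all_algebra.
From mathcomp Require Import all_classical all_reals all_analysis.

Set Implicit Arguments.
Unset Strict Implicit.
Unset Printing Implicit Defensive.

Import Order.TTheory GRing.Theory Num.Theory.
Import numFieldNormedType.Exports.

Local Open Scope classical_set_scope.
Local Open Scope ring_scope.

(* A real J x ... x J array with D modes, indexed by its multi-indices. *)
Definition tensor (R : Type) (J D : nat) : Type :=
  {ffun {ffun 'I_D -> 'I_J} -> R}.

Fact digit_subproof (J D : nat) (k : 'I_(J ^ D)) (d : 'I_D) :
  ((k %/ J ^ d) %% J < J)%N.
Proof.
apply: ltn_pmod; case: J k => [|//] [k hk] /=.
by move: hk; rewrite exp0n // (leq_ltn_trans _ (ltn_ord d)).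
Qed.

(* Column-major (first index fastest) multi-index of the linear index
   k = i_0 + i_1 J + ... + i_(D-1) J^(D-1). *)
Definition multi_index (J D : nat) (k : 'I_(J ^ D)) : {ffun 'I_D -> 'I_J} :=
  [ffun d : 'I_D => Ordinal (digit_subproof k d)].

Fact multi_index_bij (J D : nat) : bijective (@multi_index J D).
Proof.
apply: inj_card_bij; last by rewrite card_ffun !card_ord.
move=> k l /ffunP kl.
have E (d : nat) : (d <= D)%N -> (k %% J ^ d = l %% J ^ d)%N.
  elim: d => [|d IH] dD; first by rewrite expn0 !modn1.
  have := congr1 val (kl (Ordinal dD)); rewrite !ffunE /= => e.
  have Jgt0 : (0 < J)%N.
    exact: leq_ltn_trans (leq0n _) (digit_subproof k (Ordinal dD)).
  have step (n : nat) :
      (n %% J ^ d.+1 = (n %/ J ^ d) %% J * J ^ d + n %% J ^ d)%N.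
    rewrite {1}(divn_eq n (J ^ d)) {1}(divn_eq (n %/ J ^ d) J).
    rewrite mulnDl -mulnA -expnS -addnA modnMDl.
    rewrite modn_small // expnS.
    have a := ltn_pmod (n %/ J ^ d) Jgt0.
    have b : (n %% J ^ d < J ^ d)%N by rewrite ltn_pmod // expn_gt0 Jgt0.
    apply: (@leq_trans (((n %/ J ^ d) %% J).+1 * J ^ d)).
      by rewrite mulSn addnC ltn_add2r.
    by rewrite leq_mul2r a orbT.
  by rewrite !step e IH // ltnW.
by apply: val_inj; have := E D (leqnn D); rewrite !modn_small.
Qed.

Definition vec (R : Type) (J D : nat) (W : tensor R J D) : 'cV[R]_(J ^ D) :=
  \col_(k < J ^ D) W (multi_index k).

Definition skew_invariant (R : realType) (n : nat) (P : 'M[R]_n)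
  (w : 'cV[R]_n) : Prop := P *m w = - w.

Definition has_order (R : realType) (n : nat) (P : 'M[R]_n) (K : nat) : Prop :=
  [/\ (0 < K)%N, P ^+ K = 1%:M
    & forall k : nat, (0 < k < K)%N -> P ^+ k <> 1%:M].

Definition skew_covariance (R : realType) (n : nat) (P : 'M[R]_n) (K : nat) :
  'M[R]_n := K%:R^-1 *: \sum_(1 <= k < K.+1) (-1) ^+ k *: P ^+ k.

Definition covariance_matrix (R : realType) (n : nat) (S : 'M[R]_n) : Prop :=
  S^T = S /\ forall a : 'cV[R]_n, 0 <= (a^T *m S *m a) 0 0.

(* The normal law N(m, v) on R with variance v >= 0, degenerate for v = 0
   ([normal_prob m 0] is not the Dirac mass at m). *)
Definition normal_law (R : realType) (m v : R) (B : set R) : \bar R :=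
  if v == 0 then \d_m B else normal_prob m (Num.sqrt v) B.

(* X ~ N(m, S), S possibly singular: every linear form a^T X has law
   N(a^T m, a^T S a). *)
Definition gaussian_vector (d : measure_display) (T : measurableType d)
    (R : realType) (Pr : probability T R) (n : nat)
    (X : T -> 'cV[R]_n) (m : 'cV[R]_n) (S : 'M[R]_n) : Prop :=
  [/\ covariance_matrix S,
      forall i : 'I_n, measurable_fun [set: T] (fun t => X t i 0)
    & forall (a : 'cV[R]_n) (B : set R), measurable B ->
        Pr [set t | B ((a^T *m X t) 0 0)] =
        normal_law ((a^T *m m) 0 0) ((a^T *m S *m a) 0 0) B].

(* Main.v *)
(** Since [P^(K+1) = P] and [K] is even, multiplying the alternating sum by [P]
    shifts it into its opposite: [P S = - S] for [S = skew_covariance P K].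
    As [P] is orthogonal, also [S^T P = - S^T], so [S^T P^k = (-1)^k S^T], and
    averaging gives [S^T S = S^T]: [S] is an orthogonal projection, so a
    covariance matrix.  Moreover every coordinate of
    [(1 + P) X] has variance zero under [N(w0, S)], so it is almost surely
    equal to its mean, the same coordinate of [(1 + P) w0]. *)
Require Import Defs.
From HB Require Import structures.
From mathcomp Require Import all_boot all_order all_fingroup all_algebra.
From mathcomp Require Import all_classical all_reals all_analysis.

Import Order.TTheory GRing.Theory Num.Theory.
Import numFieldNormedType.Exports.

Local Open Scope classical_set_scope.
Local Open Scope ring_scope.

Lemma mul_skew_covariance (R : realType) (n : nat) (P : 'M[R]_n) (K : nat) :
  P ^+ K = 1%:M -> ~~ odd K ->
  P *m skew_covariance P K = - skew_covariance P K.
Proof.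
move=> PK evK; rewrite /skew_covariance -scalemxAr -scalerN; congr (_ *: _).
rewrite mulmx_sumr.
under eq_bigr => k _ do
  rewrite -scalemxAr (_ : P *m P ^+ k = P ^+ k.+1) ?exprS //.
rewrite -sumrN; apply/eqP; rewrite -subr_eq0 -sumrB.
(* Each summand is minus a consecutive difference of [(-1)^k P^k], so the sum telescopes; its end
   terms at [K+1] and [1] both equal [-P], as [P^K = 1] and [K] is even. *)
rewrite (eq_bigr (fun k => - ((-1) ^+ k.+1 *: P ^+ k.+1 - (-1) ^+ k *: P ^+ k))).
  rewrite sumrN telescope_sumr // [P ^+ K.+1]exprS PK exprS -signr_odd (negbTE evK).
  by rewrite expr0 mulr1 expr1 (mulmx1 P : P * 1%:M = P) subrr oppr0.
by move=> k _; rewrite [(-1) ^+ k.+1]exprS mulN1r scaleNr exprS opprD !opprK.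
Qed.

(** All [K] terms [(-1)^k A P^k] of the average equal [A], the two signs cancelling. *)
Lemma mul_skew_covariance_id (R : realType) (m n : nat) (P : 'M[R]_n) (K : nat)
    (A : 'M[R]_(m, n)) :
  (0 < K)%N -> A *m P = - A -> A *m skew_covariance P K = A.
Proof.
move=> K0 AP; rewrite /skew_covariance -scalemxAr mulmx_sumr.
have APk k : A *m P ^+ k = (-1) ^+ k *: A.
  elim: k => [|k IH]; first by rewrite !expr0 scale1r mulmx1.
  rewrite exprSr [P ^+ k * P](_ : _ = P ^+ k *m P) //.
  by rewrite mulmxA IH -scalemxAl AP exprS mulN1r scaleNr scalerN.
have sgnK k : (-1) ^+ k *: ((-1) ^+ k *: A) = A.
  by rewrite scalerA -exprD addnn -signr_odd odd_double scale1r.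
have AK : K%:R^-1 *: (A *+ K) = A.
  by rewrite -(scaler_nat K A) scalerK // pnatr_eq0 -lt0n.
rewrite (eq_bigr (fun=> A)); first by rewrite sumr_const_nat subn1.
by move=> k _; rewrite -scalemxAr APk; exact: sgnK.
Qed.

Lemma skew_covarianceP (R : realType) (n : nat) (P : 'M[R]_n) (K : nat) :
  P^T *m P = 1%:M -> has_order P K -> ~~ odd K ->
  covariance_matrix (skew_covariance P K).
Proof.
move=> PTP [K0 PK _] evK; have PS := @mul_skew_covariance _ _ _ _ PK evK.
set S := skew_covariance P K in PS *.
have STS : S^T *m S = S^T.
  apply: mul_skew_covariance_id => //.
  have PTS : P^T *m S = - S.
    by rewrite -[in LHS](opprK S) -PS mulmxN mulmxA PTP mul1mx.
  by rewrite -[P]trmxK -trmx_mul PTS linearN.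
have Ssym : S^T = S by rewrite -[RHS]trmxK -[in RHS]STS trmx_mul trmxK STS.
split=> // a.
(* The quadratic form is the squared norm of [S a]. *)
have -> : a^T *m S *m a = (S *m a)^T *m (S *m a).
  by rewrite trmx_mul mulmxA -(mulmxA a^T S^T) STS Ssym.
by rewrite mxE; apply: sumr_ge0 => i _; rewrite mxE -expr2 sqr_ge0.
Qed.

Section GaussianVector.
Context {d : measure_display} {T : measurableType d} {R : realType}.
Context {Pr : probability T R} {n : nat} {X : T -> 'cV[R]_n}.
Context {m : 'cV[R]_n} {S : 'M[R]_n}.
Hypothesis XmS : gaussian_vector Pr X m S.

Lemma gaussian_vector_measurable_form (a : 'cV[R]_n) :
  measurable_fun [set: T] (fun t => (a^T *m X t) 0 0).
Proof.
case: XmS => _ mX _.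
apply: (eq_measurable_fun (fun t => \sum_(i < n) a^T 0 i * X t i 0)).
  by move=> t _; rewrite mxE.
by apply: measurable_sum => i; exact: measurable_realfun.measurable_funM.
Qed.

(** With variance zero, [normal_law] is the Dirac mass at the mean, so the event of hitting the mean
    has probability 1 and its complement is null. *)
Lemma gaussian_vector_degenerate (a : 'cV[R]_n) :
  (a^T *m S *m a) 0 0 = 0 ->
  {ae Pr, forall t, (a^T *m X t) 0 0 = (a^T *m m) 0 0}.
Proof.
move=> v0; set c := (a^T *m m) 0 0.
have mE : measurable [set t | (a^T *m X t) 0 0 = c].
  have := gaussian_vector_measurable_form a measurableT _ (measurable_set1 c).
  by rewrite setTI.
case: XmS => _ _ /(_ a [set c] (measurable_set1 c)).
rewrite /normal_law v0 eqxx diracE mem_set //= => PrE.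
exists (~` [set t | (a^T *m X t) 0 0 = c]); split => //; first exact: measurableC.
by rewrite probability_setC // PrE subee.
Qed.

(** Each row of [A] gives a form of variance zero; finitely many almost sure equalities hold
    jointly. *)
Lemma gaussian_vector_mulmx_degenerate (p : nat) (A : 'M[R]_(p, n)) :
  A *m S = 0 -> {ae Pr, forall t, A *m X t = A *m m}.
Proof.
move=> AS.
have Ei (i : 'I_p) : {ae Pr, forall t, (A *m X t) i 0 = (A *m m) i 0}.
  have := @gaussian_vector_degenerate (row i A)^T.
  rewrite trmxK -row_mul AS row0 mul0mx mxE => /(_ erefl).
  by apply: filterS => t; rewrite -!row_mul !mxE.
have : {ae Pr, forall t, forall i : 'I_p, (A *m X t) i 0 = (A *m m) i 0}.
  exact: filter_forall.
by apply: filterS => t E; apply/matrixP => i j; rewrite ord1.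
Qed.

End GaussianVector.

(** If [Q] failed, the whole space, of probability 1, would be null. *)
Lemma ae_cst (d : measure_display) (T : measurableType d) (R : realType)
    (Pr : probability T R) (Q : Prop) : {ae Pr, forall t : T, Q} -> Q.
Proof.
case=> N [mN N0 sN]; apply: contrapT => nQ.
have NT : N = setT by apply/seteqP; split=> // t _; apply: sN.
by move: N0; rewrite NT probability_setT => /eqP; rewrite onee_eq0.
Qed.

Lemma skew_invariantE (R : realType) (n : nat) (P : 'M[R]_n) (w : 'cV[R]_n) :
  skew_invariant P w <-> (1%:M + P) *m w = 0.
Proof.
rewrite /skew_invariant mulmxDl mul1mx addrC; split=> [->|/eqP].
  by rewrite addNr.
by rewrite addr_eq0 => /eqP.
Qed.

Theorem theorem4p12 (R : realType) (J D : nat) (P : 'M[R]_(J ^ D)) (K : nat)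
    (hP : is_perm_mx P) (hK : has_order P K) (evenK : ~~ odd K) :
  covariance_matrix (skew_covariance P K) /\
  forall (d : measure_display) (T : measurableType d) (Pr : probability T R)
    (W : T -> tensor R J D) (w0 : 'cV[R]_(J ^ D)),
    gaussian_vector Pr (fun t => vec (W t)) w0 (skew_covariance P K) ->
    ({ae Pr, forall t, skew_invariant P (vec (W t))} <-> skew_invariant P w0).
Proof.
split.
  apply: skew_covarianceP => //; case/is_perm_mxP: hP => s ->.
  by rewrite tr_perm_mx -perm_mxM mulVg perm_mx1.
move=> d T Pr W w0 gW; case: hK => _ PK _.
have PS0 : (1%:M + P) *m skew_covariance P K = 0.
  by rewrite mulmxDl mul1mx mul_skew_covariance ?subrr.
have aeE := gaussian_vector_mulmx_degenerate gW _ _ PS0.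
split=> [aeW|/skew_invariantE w0P].
  (* The claim on [w0] does not involve [t], so proving it almost surely suffices. *)
  apply/skew_invariantE; apply: (@ae_cst _ _ _ Pr).
  by apply: filterS2 aeE aeW => t E /skew_invariantE; rewrite E.
by apply: filterS aeE => t E; apply/skew_invariantE; rewrite E.
Qed.
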